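(* Let $0<\alpha<1$, $\beta,\gamma,\delta\ge 0$, and let $n_0\ge 0$ be an integer. Let $(p(n))_{n\in\mathbb{N}}$ be a bounded real sequence and, for each integer $n>n_0$, let $Y(n)$ be a random variable with values in $\{0,1,\ldots,n-1\}$ such that for all $n>n_0$ $$p(n)=\mathbb{E}[p(Y(n))],\qquad |\mathbb{E}[Y(n)]-\alpha n|\le\beta,\qquad \operatorname{Var}(Y(n))\le\gamma n+\delta .$$ For each real $x>0$, let $I_0(x)\subset I_1(x)\subset\cdots$ be intervals centered at $x$, whose lengths are of order $\sqrt{x}$, and let $(q_k(x))_{k\ge 0}$ be a positive decreasing sequence with $\sum_{k}q_k(x)=1$, such that, with $$l(x)=\sum_{k=0}^\infty q_k(x)\min_{n\in\mathbb{N}\cap I_k(x)}p(n),\qquad u(x)=\sum_{k=0}^\infty q_k(x)\max_{n\in\mathbb{N}\cap I_k(x)}p(n),$$ one has $l(x)\le p([\alpha^{-i}x])\le u(x)$ for all integers $i\ge 0$. Then for all $x>0$ $$\liminf_{n\to\infty}p(n)\le u(x),\qquad \limsup_{n\to\infty}p(n)\ge l(x).$$ Furthermore, if $x_0>0$, then $$\liminf_{n\to\infty}p(n)\ge\inf_{x\in[x_0,\alpha^{-1}x_0]}l(x),\qquad \limsup_{n\to\infty}p(n)\le\sup_{x\in[x_0,\alpha^{-1}x_0]}u(x).$$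
   Context: $\mathbb{N}=\{0,1,2,\ldots\}$. $[y]$ denotes $y$ rounded to the nearest integer. The values $p(0),\ldots,p(n_0)$ are given starting values; the later terms are determined by $p(n)=\mathbb{E}[p(Y(n))]$. ''Length of order $\sqrt{x}$'' means that for each fixed $k$ the length of $I_k(x)$ lies between two positive constant multiples of $\sqrt{x}$ (the constants not depending on $x$) for all sufficiently large $x$. *)

(* Defs.v *)
From HB Require Import structures.
From mathcomp Require Import all_boot all_order all_algebra.
From mathcomp Require Import all_classical all_reals all_analysis.
Import Order.TTheory GRing.Theory Num.Theory.
Import numFieldNormedType.Exports.

Set Implicit Arguments.
Unset Strict Implicit.
Unset Printing Implicit Defensive.

Local Open Scope classical_set_scope.
Local Open Scope ring_scope.

(* Nearest integer, ties rounded up; only meant for y >= 0, where the result is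
   a natural number. *)
Definition nearest (R : realType) (y : R) : nat := Num.truncn (y + 2^-1).

(* Endpoints may be open or closed, independently of each other. *)
Definition centered_at (R : realType) (x : R) (J : interval R) : Prop :=
  exists (r : R) (a b : bool), J = Interval (BSide a (x - r)) (BSide b (x + r)).

(* The length of J k x is of order sqrt x as x grows, with constants that may
   depend on k but not on x. *)
Definition length_order_sqrt (R : realType) (J : nat -> R -> interval R) : Prop :=
  forall k, exists c C : R, [/\ 0 < c, 0 < C &
    \forall x \near +oo,
      ((c * Num.sqrt x)%:E <= lebesgue_measure [set` J k x] <=
        (C * Num.sqrt x)%:E)%E].

(* Junk value 0 when A has no minimum, resp. no maximum. *)
Definition set_min (R : realType) (A : set R) : R :=
  xget 0 [set m | A m /\ lbound A m].
Definition set_max (R : realType) (A : set R) : R :=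
  xget 0 [set m | A m /\ ubound A m].

Definition nat_points (R : realType) (J : interval R) : set nat :=
  [set n | n%:R \in J].

Definition lower_avg (R : realType) (p : nat -> R) (J : nat -> R -> interval R)
    (q : nat -> R -> R) (x : R) : R :=
  limn (series (fun k => q k x * set_min (p @` nat_points (J k x)))).

Definition upper_avg (R : realType) (p : nat -> R) (J : nat -> R -> interval R)
    (q : nat -> R -> R) (x : R) : R :=
  limn (series (fun k => q k x * set_max (p @` nat_points (J k x)))).

(* Main.v *)
Require Import Defs.
From HB Require Import structures.
From mathcomp Require Import all_boot all_order all_algebra.
From mathcomp Require Import all_classical all_reals all_analysis.
From mathcomp Require Import lra.
Import Order.TTheory GRing.Theory Num.Theory.
Import numFieldNormedType.Exports.

Set Implicit Arguments.
Unset Strict Implicit.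
Unset Printing Implicit Defensive.

Local Open Scope classical_set_scope.
Local Open Scope ring_scope.

(** The map [i |-> alpha ^- i * x] is the backward orbit of [x] under [y |-> alpha y],
    so [[x0, alpha^-1 x0]] is a fundamental domain: every natural number
    [n >= x0] is [alpha ^- i * x] for some [i] and some [x] in that interval.
    Being an integer, [n] is its own rounding, and the sandwich hypothesis at
    this [x] and [i] reads [l x <= p n <= u x]. Thus the infimum of [l] and the
    supremum of [u] over the fundamental domain bound all but finitely many
    terms of [p] ([orbit_meets_fundamental_interval]). These two extrema are
    genuine ones because [l] and [u] are averages, with weights of sum 1, of
    values bounded by the bound of [p] ([norm_weighted_average_le]).

    For a single [x], the rounded orbit of [x] is unbounded
    ([nearest_orbit_unbounded]); the sandwich then places infinitely many terms
    of [p] below [u x] and above [l x], which yields the bounds on the lower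
    and upper limits. *)

(** * Upper and lower limits of bounded sequences *)

Section LimSupInf.
Variables (R : realType) (p : nat -> R).
Hypothesis p_bounded : bounded_fun p.

Lemma limn_sup_le_eventually (c : R) (N : nat) :
  (forall n, (N <= n)%N -> p n <= c) -> limn_sup p <= c.
Proof.
move=> pc; rewrite limn_supE //; apply: (@le_trans _ _ (sups p N)).
  by apply: ge_inf; [exact: bounded_fun_has_lbound_sups | exists N].
apply: ge_sup; first by exists (p N), N => /=.
by move=> _ [n /= Nn <-]; exact: pc.
Qed.

Lemma limn_inf_ge_eventually (c : R) (N : nat) :
  (forall n, (N <= n)%N -> c <= p n) -> c <= limn_inf p.
Proof.
move=> pc; rewrite limn_infE //; apply: (@le_trans _ _ (infs p N)).
  apply: lb_le_inf; first by exists (p N), N => /=.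
  by move=> _ [n /= Nn <-]; exact: pc.
by apply: ub_le_sup; [exact: bounded_fun_has_ubound_infs | exists N].
Qed.

Lemma limn_sup_ge_frequently (c : R) :
  (forall N, exists2 n, (N <= n)%N & c <= p n) -> c <= limn_sup p.
Proof.
move=> pc; rewrite limn_supE //; apply: lb_le_inf; first by exists (sups p 0), 0%N.
move=> _ [N _ <-]; have [n Nn cn] := pc N.
apply: (le_trans cn); apply: ub_le_sup; last by exists n.
exact/has_ubound_sdrop/bounded_fun_has_ubound.
Qed.

Lemma limn_inf_le_frequently (c : R) :
  (forall N, exists2 n, (N <= n)%N & p n <= c) -> limn_inf p <= c.
Proof.
move=> pc; rewrite limn_infE //; apply: ge_sup; first by exists (infs p 0), 0%N.
move=> _ [N _ <-]; have [n Nn cn] := pc N.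
apply: le_trans cn; apply: ge_inf; last by exists n.
exact/has_lbound_sdrop/bounded_fun_has_lbound.
Qed.

End LimSupInf.

(** * Averages of bounded values *)

(** Convergence is part of the point: [limn] of a divergent series is an
    arbitrary value, and it is absolute convergence that excludes this here. *)
Lemma norm_weighted_average_le (R : realType) (w f : nat -> R) (M : R) :
  (forall k, 0 <= w k) -> series w @ \oo --> (1 : R) ->
  (forall k, `|f k| <= M) ->
  `|limn (series (fun k => w k * f k))| <= M.
Proof.
move=> w0 w1 fM; have cw : cvgn (series w) by apply/cvg_ex; exists 1.
have cMw : cvgn (series (M *: w)) by exact: is_cvg_seriesZ.
have wfM k : `|w k * f k| <= (M *: w) k.
  by rewrite normrM ger0_norm // mulrC; exact: ler_wpM2r.
have cwf : cvgn [normed series (fun k => w k * f k)].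
  apply: (series_le_cvg _ _ wfM cMw) => k; first exact: normr_ge0.
  exact: le_trans (normr_ge0 _) (wfM k).
have := lim_series_le cwf cMw wfM.
rewrite lim_seriesZ // (cvg_lim _ w1) // [_ *: _]mulr1.
by apply: le_trans; exact: (lim_series_norm cwf).
Qed.

(** The hypothesis [0 <= M] accounts for sets without a maximum, where
    [set_max] is 0. *)
Lemma norm_set_max_le (R : realType) (A : set R) (M : R) :
  0 <= M -> (forall a, A a -> `|a| <= M) -> `|set_max A| <= M.
Proof.
by move=> M0 AM; rewrite /set_max; case: xgetP => [m _ [/AM]|]; rewrite ?normr0.
Qed.

Lemma norm_set_min_le (R : realType) (A : set R) (M : R) :
  0 <= M -> (forall a, A a -> `|a| <= M) -> `|set_min A| <= M.
Proof.
by move=> M0 AM; rewrite /set_min; case: xgetP => [m _ [/AM]|]; rewrite ?normr0.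
Qed.

(** * Orbits of a dilation *)

Lemma nearest_nat (R : realType) (n : nat) : nearest (n%:R : R) = n.
Proof. by apply: truncn_def; rewrite -[n.+1%:R]natr1; lra. Qed.

Lemma expr_lt_eventually (R : realType) (alpha e : R) :
  0 < alpha -> alpha < 1 -> 0 < e -> exists i, alpha ^+ i < e.
Proof.
move=> a0 a1 e0; have na : `|alpha| < 1 by rewrite gtr0_norm.
have /cvgrPdist_lt /(_ e e0) [i _ /(_ i (leqnn i))] := cvg_expr na.
by rewrite /= sub0r normrN ger0_norm ?exprn_ge0 ?ltW //; exists i.
Qed.

Lemma nearest_orbit_unbounded (R : realType) (alpha x : R) (N : nat) :
  0 < alpha -> alpha < 1 -> 0 < x ->
  exists i, (N <= nearest (alpha ^- i * x))%N.
Proof.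
move=> a0 a1 x0; have N0 : 0 < N.+1%:R :> R by rewrite ltr0n.
have [i ai] := expr_lt_eventually a0 a1 (divr_gt0 x0 N0).
exists i; have ai0 : 0 < alpha ^+ i by rewrite exprn_gt0.
have Nx : N.+1%:R < alpha ^- i * x.
  by rewrite mulrC ltr_pdivlMr // mulrC -ltr_pdivlMr.
rewrite /nearest truncn_ge_nat; last by lra.
by move: Nx; rewrite -[N.+1%:R]natr1; lra.
Qed.

(** The exponent is one less than the first one that brings [alpha ^+ i * y]
    below [x0]. *)
Lemma orbit_meets_fundamental_interval (R : realType) (alpha x0 y : R) :
  0 < alpha -> alpha < 1 -> 0 < x0 -> x0 <= y ->
  exists i, exists2 x, x \in `[x0, alpha^-1 * x0] & alpha ^- i * x = y.
Proof.
move=> a0 a1 x0_gt0 x0y; have y0 : 0 < y by exact: lt_le_trans x0y.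
have exi : exists i, alpha ^+ i * y < x0.
  have [i] := expr_lt_eventually a0 a1 (divr_gt0 x0_gt0 y0).
  by rewrite ltr_pdivlMr //; exists i.
case: (ex_minnP exi) => -[|i] yi min_i; first by move: yi; rewrite expr0 mul1r ltNge x0y.
exists i, (alpha ^+ i * y); last by rewrite mulKf // expf_neq0 // gt_eqF.
rewrite in_itv /=; apply/andP; split.
  by rewrite leNgt; apply/negP => /min_i; rewrite ltnn.
by rewrite [leRHS]mulrC ler_pdivlMr // mulrC mulrA -exprS ltW.
Qed.

Theorem lemma3 (R : realType) (alpha beta gamma delta : R) (n0 : nat)
    (halpha0 : 0 < alpha) (halpha1 : alpha < 1)
    (hbeta : 0 <= beta) (hgamma : 0 <= gamma) (hdelta : 0 <= delta)
    (p : nat -> R) (hp : bounded_fun p)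
    (d : nat -> measure_display) (T : forall n, measurableType (d n))
    (P : forall n, probability (T n) R) (Y : forall n, {RV (P n) >-> nat})
    (hYval : forall n, (n0 < n)%N -> forall w, (Y n w < n)%N)
    (hYp : forall n, (n0 < n)%N -> ((p n)%:E = 'E_(P n)[fun w => p (Y n w)])%E)
    (hYmean : forall n, (n0 < n)%N ->
      (`| 'E_(P n)[fun w => (Y n w)%:R] - (alpha * n%:R)%:E | <= beta%:E)%E)
    (hYvar : forall n, (n0 < n)%N ->
      ('V_(P n)[fun w => (Y n w)%:R] <= (gamma * n%:R + delta)%:E)%E)
    (J : nat -> R -> interval R) (q : nat -> R -> R)
    (hJnested : forall x, 0 < x -> forall k,
      [set` J k x] `<=` [set` J k.+1 x])
    (hJcentered : forall x, 0 < x -> forall k, centered_at x (J k x))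
    (hJnonempty : forall x, 0 < x -> forall k, nat_points (J k x) !=set0)
    (hJlength : length_order_sqrt J)
    (hqpos : forall x, 0 < x -> forall k, 0 < q k x)
    (hqdecr : forall x, 0 < x -> nonincreasing_seq (fun k => q k x))
    (hqsum : forall x, 0 < x -> series (fun k => q k x) @ \oo --> (1 : R))
    (hlu : forall x, 0 < x -> forall i : nat,
      lower_avg p J q x <= p (nearest (alpha ^- i * x)) <= upper_avg p J q x) :
  (forall x, 0 < x ->
     limn_inf p <= upper_avg p J q x /\ lower_avg p J q x <= limn_sup p) /\
  (forall x0, 0 < x0 ->
     inf [set lower_avg p J q x | x in `[x0, alpha^-1 * x0]] <= limn_inf p /\
     limn_sup p <= sup [set upper_avg p J q x | x in `[x0, alpha^-1 * x0]]).
Proof.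
have [M M0 pM] : exists2 M, 0 < M & forall n, `|p n| <= M.
  by have [M M0 pM] := pinfty_ex_gt0 hp; exists M => // n; exact: pM.
have fundamental_pos x0 x : 0 < x0 -> x \in `[x0, alpha^-1 * x0] -> 0 < x.
  by move=> x0_gt0; rewrite in_itv => /andP[/(lt_le_trans x0_gt0)].
have sandwich_tail x0 n : 0 < x0 -> x0 <= n%:R -> exists2 x,
    x \in `[x0, alpha^-1 * x0] & lower_avg p J q x <= p n <= upper_avg p J q x.
  move=> x0_gt0 /(orbit_meets_fundamental_interval halpha0 halpha1 x0_gt0).
  move=> [i [x xI xn]]; exists x => //.
  by have := hlu x (fundamental_pos x0 x x0_gt0 xI) i; rewrite xn nearest_nat.
have avg_le x f : 0 < x -> (forall k, `|f k| <= M) ->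
    `|limn (series (fun k => q k x * f k))| <= M.
  move=> x_gt0; apply: norm_weighted_average_le; last exact: hqsum.
  by move=> k; exact/ltW/hqpos.
have lM x : 0 < x -> `|lower_avg p J q x| <= M.
  move=> x_gt0; apply: avg_le => // k.
  by apply: norm_set_min_le (ltW M0) _ => _ [n _ <-].
have uM x : 0 < x -> `|upper_avg p J q x| <= M.
  move=> x_gt0; apply: avg_le => // k.
  by apply: norm_set_max_le (ltW M0) _ => _ [n _ <-].
split=> [x x_gt0|x0 x0_gt0].
  have frequently (Q : R -> Prop) : (forall i, Q (p (nearest (alpha ^- i * x)))) ->
      forall N, exists2 n, (N <= n)%N & Q (p n).
    move=> Qp N; have [i Ni] := nearest_orbit_unbounded N halpha0 halpha1 x_gt0.
    by exists (nearest (alpha ^- i * x)).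
  split.
    apply: limn_inf_le_frequently => //; apply: (frequently (fun v => v <= _)) => i.
    by have /andP[] := hlu x x_gt0 i.
  apply: limn_sup_ge_frequently => //; apply: (frequently (fun v => _ <= v)) => i.
  by have /andP[] := hlu x x_gt0 i.
have x0_le n : ((Num.truncn x0).+1 <= n)%N -> x0 <= n%:R.
  by rewrite -(ler_nat R) => /(lt_le_trans (truncnS_gt x0)) /ltW.
split.
- apply: (@limn_inf_ge_eventually _ _ hp _ (Num.truncn x0).+1) => n /x0_le x0n.
  have [x xI /andP[lp _]] := sandwich_tail x0 n x0_gt0 x0n.
  apply: le_trans lp; apply: ge_inf; last by exists x.
  exists (- M) => _ [z zI <-].
  by have /lM := fundamental_pos x0 z x0_gt0 zI; rewrite ler_norml => /andP[].
- apply: (@limn_sup_le_eventually _ _ hp _ (Num.truncn x0).+1) => n /x0_le x0n.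
  have [x xI /andP[_ pu]] := sandwich_tail x0 n x0_gt0 x0n.
  apply: (le_trans pu); apply: ub_le_sup; last by exists x.
  exists M => _ [z zI <-].
  by have /uM := fundamental_pos x0 z x0_gt0 zI; rewrite ler_norml => /andP[].
Qed.
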